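(* Let $q$ be a power of the prime $p$ and $k$ a field of characteristic $p$ containing $\mathbb F_q$. Then $kM(n,q)$ has infinite representation type for all $n\geq2$. On the other hand, $kM(1,q)\cong k^q$ is semisimple.
   Context: $M(n,q)$ is the multiplicative monoid of all $n\times n$ matrices over the field $\mathbb F_q$ with $q$ elements, and $kM(n,q)$ is its monoid algebra over $k$. A finite dimensional algebra has infinite representation type if it has infinitely many isomorphism classes of finite dimensional indecomposable modules. *)

(* Defs.v *)
From HB Require Import structures.
From mathcomp Require Import all_boot all_order all_algebra all_field.

Set Implicit Arguments.
Unset Strict Implicit.
Unset Printing Implicit Defensive.

Import GRing.Theory.

Local Open Scope ring_scope.

(* The monoid algebra kM(n,q), with F the field of q elements: a function f   *)
(* stands for the formal sum of the (f A) A. The type is a separate constant  *)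
(* because {ffun 'M[F]_n -> k} already carries the pointwise product; here    *)
(* the product is convolution along matrix multiplication.                    *)
Definition mxmonalg (k : fieldType) (F : finFieldType) (n : nat) : Type :=
  {ffun 'M[F]_n -> k^o}.

Section MatrixMonoidAlgebra.

Variables (k : fieldType) (F : finFieldType) (n : nat).

Local Notation kM := (mxmonalg k F n).

HB.instance Definition _ := Vector.copy kM {ffun 'M[F]_n -> k^o}.

Implicit Types f g h : kM.

Definition mxmonalg_one : kM := [ffun C => (C == 1%:M)%:R].

Definition mxmonalg_mul f g : kM :=
  [ffun C => \sum_A \sum_(B | A *m B == C) (f A * g B : k)].

Lemma mxmonalg_mul_sum f g (phi : 'M[F]_n -> k) :
  \sum_C mxmonalg_mul f g C * phi C
    = \sum_A \sum_B f A * g B * phi (A *m B) :> k.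
Proof.
under eq_bigr do rewrite ffunE mulr_suml.
rewrite exchange_big; apply: eq_bigr => A _ /=.
under eq_bigr do rewrite mulr_suml big_mkcond.
rewrite exchange_big; apply: eq_bigr => B _ /=.
by rewrite -big_mkcond (big_pred1 (A *m B)) // => C; rewrite eq_sym.
Qed.

Fact mxmonalg_mulA : associative mxmonalg_mul.
Proof.
move=> f g h; apply/ffunP=> D; rewrite [LHS]ffunE [RHS]ffunE.
transitivity (\sum_A f A * (\sum_E mxmonalg_mul g h E * (A *m E == D)%:R) : k).
  apply: eq_bigr => A _; rewrite mulr_sumr big_mkcond; apply: eq_bigr => E _.
  by case: eqP; rewrite ?mulr1 ?mulr0.
transitivity (\sum_E mxmonalg_mul f g E * (\sum_(C | E *m C == D) h C) : k).
  rewrite mxmonalg_mul_sum; apply: eq_bigr => A _.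
  rewrite mxmonalg_mul_sum mulr_sumr; apply: eq_bigr => B _.
  rewrite !mulr_sumr [RHS]big_mkcond; apply: eq_bigr => C _.
  by rewrite mulmxA; case: eqP; rewrite ?mulr1 ?mulr0 ?mulrA.
by apply: eq_bigr => E _; rewrite mulr_sumr.
Qed.

Fact mxmonalg_mul1l : left_id mxmonalg_one mxmonalg_mul.
Proof.
move=> f; apply/ffunP=> C; rewrite ffunE (bigD1 1%:M) //= [X in _ + X]big1.
  rewrite addr0 (big_pred1 C) => [|B]; last by rewrite mul1mx.
  by rewrite ffunE eqxx mul1r.
by move=> A /negPf nA; rewrite big1 // => B _; rewrite ffunE nA mul0r.
Qed.

Fact mxmonalg_mul1r : right_id mxmonalg_one mxmonalg_mul.
Proof.
move=> f; apply/ffunP=> C; rewrite ffunE.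
under eq_bigr do rewrite big_mkcond.
rewrite exchange_big (bigD1 1%:M) //= [X in _ + X]big1.
  rewrite addr0 -big_mkcond (big_pred1 C) => [|A]; last by rewrite mulmx1.
  by rewrite ffunE eqxx mulr1.
move=> B /negPf nB; rewrite big1 // => A _.
by case: ifP; rewrite // ffunE nB mulr0.
Qed.

Fact mxmonalg_mulDl : left_distributive mxmonalg_mul +%R.
Proof.
move=> f g h; apply/ffunP=> C; rewrite !ffunE -big_split.
apply: eq_bigr => A _ /=; rewrite -big_split.
by apply: eq_bigr => B _; rewrite ffunE mulrDl.
Qed.

Fact mxmonalg_mulDr : right_distributive mxmonalg_mul +%R.
Proof.
move=> f g h; apply/ffunP=> C; rewrite !ffunE -big_split.
apply: eq_bigr => A _ /=; rewrite -big_split.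
by apply: eq_bigr => B _; rewrite ffunE mulrDr.
Qed.

Fact mxmonalg_oner_neq0 : mxmonalg_one != 0.
Proof.
by apply/eqP=> /ffunP/(_ 1%:M)/eqP; rewrite !ffunE eqxx oner_eq0.
Qed.

HB.instance Definition _ := GRing.Zmodule_isNzRing.Build kM
  mxmonalg_mulA mxmonalg_mul1l mxmonalg_mul1r mxmonalg_mulDl mxmonalg_mulDr
  mxmonalg_oner_neq0.

Fact mxmonalg_scalerAl (a : k) f g : a *: (f * g) = a *: f * g.
Proof.
apply/ffunP=> C; rewrite !ffunE scaler_sumr; apply: eq_bigr => A _.
rewrite scaler_sumr; apply: eq_bigr => B _.
by rewrite ffunE; apply: mulrA.
Qed.

HB.instance Definition _ := GRing.Lmodule_isLalgebra.Build k kM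
  mxmonalg_scalerAl.

Fact mxmonalg_scalerAr (a : k) f g : a *: (f * g) = f * (a *: g).
Proof.
apply/ffunP=> C; rewrite !ffunE scaler_sumr; apply: eq_bigr => A _.
rewrite scaler_sumr; apply: eq_bigr => B _.
by rewrite ffunE; apply: mulrCA.
Qed.

HB.instance Definition _ := GRing.Lalgebra_isAlgebra.Build k kM
  mxmonalg_scalerAr.

HB.instance Definition _ := Algebra_isFalgebra.Build k kM.

Definition mxmonalg_of (A : 'M[F]_n) : kM := [ffun C => (C == A)%:R].

Lemma mxmonalg_ofM A B : mxmonalg_of (A *m B) = mxmonalg_of A * mxmonalg_of B.
Proof.
apply/ffunP=> C; rewrite !ffunE (bigD1 A) //= [X in _ + X]big1 => [|A' /negPf nA].
  rewrite addr0 big_mkcond (bigD1 B) //= big1 => [|B' /negPf nB].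
    by rewrite !ffunE !eqxx addr0 mulr1 eq_sym; case: eqP.
  by case: ifP; rewrite // !ffunE nB mulr0.
by rewrite big1 // => B' _; rewrite ffunE nA mul0r.
Qed.

End MatrixMonoidAlgebra.

Section Modules.

Variable R : pzRingType.
Implicit Types M N : lmodType R.

Definition mod_iso M N : Prop := exists f : {linear M -> N}, bijective f.

Definition submodule M (U : M -> Prop) : Prop :=
  U 0 /\ forall (a : R) (x y : M), U x -> U y -> U (a *: x + y).

Definition zero_submodule M (U : M -> Prop) : Prop := forall x, U x -> x = 0.

Definition indecomposable M : Prop :=
  (exists x : M, x <> 0) /\
  forall U V : M -> Prop, submodule U -> submodule V ->
    (forall x, exists u v, [/\ U u, V v & x = u + v]) ->
    (forall x, U x -> V x -> x = 0) ->
    zero_submodule U \/ zero_submodule V.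

Definition simple_submodule M (U : M -> Prop) : Prop :=
  [/\ submodule U, exists2 x, U x & x <> 0 &
      forall W : M -> Prop, submodule W -> (forall x, W x -> U x) ->
        zero_submodule W \/ (forall x, U x -> W x)].

(* R is the internal direct sum of finitely many simple left ideals.          *)
Definition semisimple_ring : Prop :=
  exists (m : nat) (U : 'I_m -> R^o -> Prop),
    (forall i, simple_submodule (U i)) /\
    (forall x : R^o, exists! u : {ffun 'I_m -> R^o},
       (forall i, U i (u i)) /\ x = \sum_i u i).

End Modules.

Section RepresentationType.

Variables (k : fieldType) (A : falgType k).

Definition fin_dim_module (M : lmodType A) : Prop :=
  exists (m : nat) (e : 'I_m -> M), forall x : M,
    exists c : 'I_m -> k, x = \sum_i (c i)%:A *: e i.

(* The L i need not be indecomposable themselves: they only have to meet every  *)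
(* isomorphism class of finite dimensional indecomposable modules.            *)
Definition finite_rep_type : Prop :=
  exists (m : nat) (L : 'I_m -> lmodType A), forall M : lmodType A,
    fin_dim_module M -> indecomposable M -> exists i, mod_iso M (L i).

Definition infinite_rep_type : Prop := ~ finite_rep_type.

End RepresentationType.

(* Main.v *)
(* Let A = kM(n,q) with n >= 2, let alpha be the sum of all invertible matrices *)
(* and lambda the sum of v u over all columns v and rows u. A singular matrix   *)
(* annihilates both of them on both sides, because the fibres of                *)
(* multiplication by it are unions of free orbits of the p-group F; hence       *)
(* x alpha = alpha x = eps(x) alpha, and likewise for lambda, where eps(x) is   *)
(* the sum of the coefficients of x at the invertible matrices. So alpha and    *)
(* lambda make every A-module M a Kronecker module M => M, and the iterated     *)
(* images of 0 under the relation { (lambda w, alpha w) } form a chain of       *)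
(* subspaces of M. The linear maps f : A -> k^(m+1) such that                   *)
(* f(lambda) = f(alpha) S, with S a nilpotent Jordan block, form a module whose *)
(* chain is still strictly growing at step m. This property passes to a direct  *)
(* summand, so a module with it and the least number of generators is           *)
(* indecomposable; it bounds the dimension below by m + 1, whence infinitely    *)
(* many indecomposables.                                                        *)
(* For n = 1 the characters x |-> x ^ i, i < q, of the monoid F form an         *)
(* invertible Vandermonde matrix.                                               *)
Require Import Defs.
From HB Require Import structures.
From mathcomp Require Import all_boot all_order all_algebra all_field.
From mathcomp Require Import boolp.

Set Implicit Arguments.
Unset Strict Implicit.
Unset Printing Implicit Defensive.

Import GRing.Theory.

Local Open Scope ring_scope.

(** Infinite type is read off from one invariant, without classifying modules: how long the chain of
    images of 0 under { (b w, a w) } keeps growing. Growth at step m passes to one of two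
    complementary summands ([grows_direct]) and fails in dimension at most m
    ([spanned_by_not_grows]), so modules growing arbitrarily long force infinitely many
    indecomposables ([grows_infinite_rep_type]). Such modules exist over any algebra with two
    independent elements that every x multiplies, on either side, by the same scalar eps(x)
    ([common_eigenvectors_infinite_rep_type]). In kM(n,q) with n at least 2 these are alpha and
    lambda: under a singular matrix their terms fall into equal batches of q, and q is 0 in k
    ([sum_free_action0]). For n = 1 the q power characters give the isomorphism with k^q
    ([power_chars_bij]). *)

(** * Submodules as modules *)

Section SubmoduleType.

Variables (R : pzRingType) (M : lmodType R) (U : M -> Prop).
Hypothesis subU : submodule U.

Definition submod_pred of submodule U : {pred M} := fun x => `[< U x >].

Fact submod_pred_closed : submod_closed (submod_pred subU).
Proof.
by case: subU => U0 UD; split=> [|a x y /asboolP Ux /asboolP Uy];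
  apply/asboolP; auto.
Qed.

HB.instance Definition _ :=
  GRing.isSubmodClosed.Build R M (submod_pred subU) submod_pred_closed.

Inductive submod_type := SubmodElt x of x \in submod_pred subU.
Definition submod_val u := let: SubmodElt x _ := u in x.

HB.instance Definition _ := [isSub for submod_val].
HB.instance Definition _ := [Choice of submod_type by <:].
HB.instance Definition _ := [SubChoice_isSubLmodule of submod_type by <:].

Lemma submod_valP u : U (submod_val u).
Proof. by have /asboolP := valP u. Qed.

Lemma submod_val_surj x : U x -> exists u, submod_val u = x.
Proof.
move=> Ux; have Sx : x \in submod_pred subU by apply/asboolP.
by exists (SubmodElt Sx).
Qed.

Lemma submod_valB u v : submod_val (u - v) = submod_val u - submod_val v.
Proof. exact: (raddfB (val : submod_type -> M)). Qed.

Lemma submod_valZ c u : submod_val (c *: u) = c *: submod_val u.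
Proof. exact: (linearZ_LR (val : submod_type -> M)). Qed.

Lemma submod_val_is_linear : linear submod_val.
Proof. exact: (@linearP _ _ _ _ (val : submod_type -> M)). Qed.

End SubmoduleType.

(** * Growth of the chain of iterated images *)

Section Growth.

Variables (R : pzRingType) (a b : R).

(* The successive images of 0 under the relation { (b w, a w) : w in M } on M. *)
Fixpoint chain (M : lmodType R) (j : nat) (y : M) : Prop :=
  if j is j'.+1 then exists2 w, y = a *: w & chain j' (b *: w) else y = 0.

Definition grows (M : lmodType R) (m : nat) : Prop :=
  exists2 y : M, chain m.+1 y & ~ chain m y.

Lemma chainS (M : lmodType R) j (y : M) : chain j y -> chain j.+1 y.
Proof.
elim: j y => [|j IHj] y /=; first by move=> ->; exists 0; rewrite scaler0.
by case=> w -> /IHj Dw; exists w.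
Qed.

Lemma chain_leq (M : lmodType R) i j (y : M) :
  (i <= j)%N -> chain i y -> chain j y.
Proof.
move=> /subnKC <-; elim: (j - i)%N => [|d IHd]; first by rewrite addn0.
by rewrite addnS => /IHd /chainS.
Qed.

(** Each term of the chain is determined by the preceding one, so a chain that has stopped once
    never grows again. *)
Lemma grows_leq (M : lmodType R) i j : (i <= j)%N -> grows M j -> grows M i.
Proof.
move=> /subnKC <-; elim: (j - i)%N => [|d IHd]; first by rewrite addn0.
rewrite addnS => -[_ [w -> Dw] Dy]; apply: IHd; exists (b *: w) => // Dw'.
by apply: Dy; exists w.
Qed.

Lemma chain0 (M : lmodType R) j : chain j (0 : M).
Proof. exact: (@chain_leq M 0). Qed.

Lemma chain_scaleD (M : lmodType R) c j (x y : M) :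
    GRing.comm c a -> GRing.comm c b ->
  chain j x -> chain j y -> chain j (c *: x + y).
Proof.
move=> ca cb; elim: j x y => [|j IHj] x y /=.
  by move=> -> ->; rewrite scaler0 addr0.
case=> w -> Dw [v -> Dv]; exists (c *: w + v).
  by rewrite scalerDr !scalerA ca.
by rewrite scalerDr scalerA -cb -scalerA; apply: IHj.
Qed.

Lemma chain_map (M N : lmodType R) (f : M -> N) j x :
  linear f -> chain j x -> chain j (f x).
Proof.
move=> linf; have f0 : f 0 = 0.
  have := linf 1 0 0; rewrite !scale1r addr0 => /eqP.
  by rewrite -subr_eq0 opprD addNKr oppr_eq0 => /eqP.
have fZ c u : f (c *: u) = c *: f u by rewrite -[c *: u]addr0 linf f0 addr0.
elim: j x => [|j IHj] x /=; first by move=> ->.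
by case=> w -> /IHj Dw; exists (f w); rewrite -?fZ.
Qed.

Lemma grows_iso (M N : lmodType R) m : mod_iso M N -> grows M m -> grows N m.
Proof.
case=> f [g fK gK] [y Dy nDy]; exists (f y).
  by apply: chain_map Dy; apply: linearP.
move=> Dfy; apply: nDy; rewrite -(fK y); apply: chain_map Dfy => c u v.
by apply: (can_inj fK); rewrite linearP !gK.
Qed.

Section DirectSum.

Variables (M : lmodType R) (U V : M -> Prop).
Hypotheses (subU : submodule U) (subV : submodule V).
Hypothesis addUV : forall x, exists u v, [/\ U u, V v & x = u + v].
Hypothesis capUV : forall x, U x -> V x -> x = 0.

Local Notation typU := (submod_type subU).
Local Notation typV := (submod_type subV).
Local Notation valU := (@submod_val R M U subU).
Local Notation valV := (@submod_val R M V subV).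

Lemma direct_decomp x : exists (u : typU) (v : typV), x = valU u + valV v.
Proof.
have [_ [_ [/(submod_val_surj subU)[u <-] /(submod_val_surj subV)[v <-] ->]]] :=
  addUV x.
by exists u, v.
Qed.

Lemma direct_inj (u u' : typU) (v v' : typV) :
  valU u + valV v = valU u' + valV v' -> u = u' /\ v = v'.
Proof.
have valI (W : M -> Prop) (subW : submodule W) (w w' : submod_type subW) :
  submod_val w - submod_val w' = 0 -> w = w'.
  by move=> /eqP; rewrite subr_eq0 => /eqP /val_inj.
move=> eq_uv; have eqB : valU u - valU u' = valV v' - valV v.
  by apply/eqP; rewrite subr_eq addrAC eq_sym subr_eq addrC eq_sym eq_uv addrC.
have B0 : valU u - valU u' = 0.
  by apply: capUV; [rewrite -submod_valB | rewrite eqB -submod_valB];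
    apply: submod_valP.
by split; [apply: valI | apply/esym/valI; rewrite -eqB].
Qed.

Lemma chain_direct j (u : typU) (v : typV) :
  chain j (valU u + valV v) -> chain j u /\ chain j v.
Proof.
elim: j u v => [|j IHj] u v /=.
  move=> uv0; apply: direct_inj; rewrite uv0.
  by rewrite -(subrr u) -(subrr v) !submod_valB !subrr addr0.
case=> w; have [u' [v' ->]] := direct_decomp w.
rewrite !scalerDr -!submod_valZ => /direct_inj[-> ->] /IHj[Du Dv].
by split; [exists u' | exists v'].
Qed.

(** If both components lay in term m of their chains, so would their sum. *)
Lemma grows_direct m : grows M m -> grows typU m \/ grows typV m.
Proof.
case=> y; have [u [v ->]] := direct_decomp y => /chain_direct[Du Dv] nD.
have [Du'|nDu] := pselect (chain m u); last by left; exists u.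
right; exists v => // Dv'; apply: nD; rewrite -[valU u]scale1r.
by apply: chain_scaleD; rewrite /GRing.comm ?mul1r ?mulr1 //;
  apply: chain_map => //; apply: submod_val_is_linear.
Qed.

End DirectSum.

End Growth.

(** * Growth and representation type *)

Section GrowthAndRepresentationType.

Variables (k : fieldType) (A : falgType k) (a b : A).

Definition spanned_by (M : lmodType A) (d : nat) : Prop :=
  exists e : 'I_d -> M, forall x : M,
    exists c : 'I_d -> k, x = \sum_i (c i)%:A *: e i.

Lemma scalar_comm (c : k) (x : A) : GRing.comm c%:A x.
Proof. by rewrite /GRing.comm -scalerAl -scalerAr mul1r mulr1. Qed.

Lemma chain_sum (M : lmodType A) (I : finType) (P : pred I) (c : I -> k)
    (y : I -> M) j :
    (forall i, P i -> chain a b j (y i)) ->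
  chain a b j (\sum_(i | P i) (c i)%:A *: y i).
Proof.
move=> Dy; elim/big_rec: _ => [|i x Pi Dx]; first exact: chain0.
by apply: chain_scaleD; [exact: scalar_comm | exact: scalar_comm | exact: Dy |].
Qed.

(* Witnesses of the d.+1 strict inclusions of the chain would be linearly      *)
(* independent over k.                                                         *)
Lemma spanned_by_not_grows (M : lmodType A) d :
  spanned_by M d -> ~ grows a b M d.
Proof.
case=> e spe gr.
have /choice[y yP] (j : 'I_d.+1) : exists y : M,
    chain a b j.+1 y /\ ~ chain a b j y.
  by have [y ? ?] := grows_leq (ltnSE (ltn_ord j)) gr; exists y.
have /choice[c cP] j := spe (y j).
pose C := \matrix_(j < d.+1, i < d) c j i.
have /rowV0Pn[r /sub_kermxP rC r_neq0] : kermx C != 0.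
  rewrite kermx_eq0 /row_free; apply/negP => /eqP rkC.
  by have := rank_leq_col C; rewrite rkC ltnn.
have sum0 : \sum_j (r 0 j)%:A *: y j = 0.
  transitivity (\sum_i (\sum_j r 0 j * C j i)%:A *: e i).
    under eq_bigr => j _ do rewrite cP scaler_sumr.
    rewrite exchange_big; apply: eq_bigr => i _ /=.
    rewrite scaler_suml scaler_suml; apply: eq_bigr => j _.
    by rewrite scalerA mxE -scalerAl mul1r scalerA.
  apply: big1 => i _; have /rowP/(_ i) := rC.
  by rewrite !mxE => ->; rewrite !scale0r.
have [j0 rj0] : exists j, r 0 j != 0.
  by have /rV0Pn := r_neq0.
(* For the last j with nonzero coefficient, [y j] is a combination of earlier [y i], all in term j
   of the chain, which [y j] avoids. *)
case: (@arg_maxnP _ j0 (fun j => r 0 j != 0) (fun j => j) rj0) => j rj jmax.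
case: (yP j) => _; apply.
have -> : y j = \sum_(i | i != j) (- (r 0 j)^-1 * r 0 i)%:A *: y i.
  have := sum0; rewrite (bigD1 j) //= => /eqP; rewrite addr_eq0 => /eqP yj.
  have -> : y j = (r 0 j)^-1%:A *: ((r 0 j)%:A *: y j).
    by rewrite scalerA -scalerAl mul1r scalerA mulVf // !scale1r.
  rewrite yj scalerN -scaleNr scaler_sumr; apply: eq_bigr => i _.
  by rewrite scalerA -scaleNr -scalerAl mul1r scalerA.
rewrite (bigID (fun i => r 0 i == 0)) /= big1 ?add0r; last first.
  by move=> i /andP[_ /eqP->]; rewrite mulr0 !scale0r.
apply: chain_sum => i /andP[i_neq_j ri].
apply: chain_leq (yP i).1; rewrite ltn_neqAle.
by rewrite (inj_eq val_inj) i_neq_j; apply: jmax.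
Qed.

(* Exchanging a generator for a nonzero element of the complement of a direct  *)
(* summand frees one generator of that summand.                                *)
Lemma spanned_by_summand (M : lmodType A) (U V : M -> Prop)
    (subU : submodule U) (subV : submodule V) d :
    (forall x, exists u v, [/\ U u, V v & x = u + v]) ->
    (forall x, U x -> V x -> x = 0) ->
    ~ zero_submodule V -> spanned_by M d ->
  exists2 d', (d' < d)%N & spanned_by (submod_type subU) d'.
Proof.
move=> addUV capUV V_neq0 [e spe].
have [v Vv v_neq0] : exists2 v, V v & v <> 0.
  apply: contrapT => nV; apply: V_neq0 => x Vx.
  by apply: contrapT => x_neq0; apply: nV; exists x.
have [c vE] := spe v.
have [i ci] : exists i, c i != 0.
  apply: contrapT => nc; apply: v_neq0; rewrite vE big1 // => i _.
  have [->|ci] := eqVneq (c i) 0; first by rewrite !scale0r.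
  by case: nc; exists i.
case: d => [|d] in e spe c vE i ci *; first by have := ltn_ord i.
exists d => //.
have /choice[u uP] (j : 'I_d) : exists u : submod_type subU,
    exists2 w, V w & e (lift i j) = submod_val u + w.
  have [_ [w [/(submod_val_surj subU)[u <-] Vw ->]]] := addUV (e (lift i j)).
  by exists u, w.
have /choice[w wP] (j : 'I_d) : exists w,
    V w /\ e (lift i j) = submod_val (u j) + w.
  by have [w] := uP j; exists w.
exists u => x; have [f xE] := spe (submod_val x).
(* Subtracting t v removes [e i] from the expansion of x and changes nothing modulo [V]; [g] holds
   the remaining coefficients. *)
pose t := f i / c i; pose g j := f (lift i j) - t * c (lift i j).
exists g; have [V0 VD] := subV.
pose z := submod_val (x - \sum_j (g j)%:A *: u j).
suff z0 : z = 0.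
  by apply/eqP; rewrite -subr_eq0 -val_eqE; apply/eqP.
apply: capUV; first exact: submod_valP.
suff -> : z = t%:A *: v + \sum_j (g j)%:A *: w j.
  apply: (VD) => //; elim/big_ind: _ => // [y y' Vy Vy'|j _].
    by rewrite -[y]scale1r; apply: VD.
  by rewrite -[_ *: _]addr0; apply: VD => //; apply: (wP j).1.
have -> : z = submod_val x - \sum_j (g j)%:A *: submod_val (u j).
  rewrite /z submod_valB; congr (_ - _).
  rewrite [LHS](raddf_sum (val : submod_type subU -> M)); apply: eq_bigr => j _.
  exact: submod_valZ.
apply/eqP; rewrite subr_eq -addrA -big_split /= xE vE; apply/eqP.
under [in RHS]eq_bigr => j _ do rewrite addrC -scalerDr -(wP j).2.
rewrite !(bigD1_ord i) //= scalerDr scaler_sumr scalerA -scalerAl mul1r scalerA.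
rewrite divfK // -addrA -big_split; congr (_ + _).
apply: eq_bigr => j _ /=.
rewrite scalerA -scalerAl mul1r scalerA -scalerDl -scalerDl.
by rewrite addrC subrK.
Qed.

(** Strong induction on the size of a spanning family over k: a nontrivial decomposition has a
    growing summand, which needs fewer elements. *)
Lemma grows_indecomposable (M : lmodType A) m :
    fin_dim_module M -> grows a b M m ->
  exists N : lmodType A,
    [/\ fin_dim_module N, indecomposable N & grows a b N m].
Proof.
case=> d; elim/ltn_ind: d M => d IHd M spM gM.
have [indM|nindM] := pselect (indecomposable M).
  by exists M; split=> //; exists d.
have M_neq0 : exists x : M, x <> 0.
  case: gM => y Dy nDy; exists y => y0.
  by apply: nDy; rewrite y0; apply: chain0.
apply: contrapT => noN; apply: nindM; split=> // U V subU subV addUV capUV.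
apply: contrapT => nUV.
have U_neq0 : ~ zero_submodule U by move=> U0; apply: nUV; left.
have V_neq0 : ~ zero_submodule V by move=> V0; apply: nUV; right.
have addVU x : exists v u, [/\ V v, U u & x = v + u].
  by have [u [v [? ? ->]]] := addUV x; exists v, u; rewrite addrC.
have capVU x : V x -> U x -> x = 0 by move=> Vx Ux; apply: capUV.
have [gU|gV] := grows_direct subU subV addUV capUV gM.
  have [d' ltd' spU] := spanned_by_summand subU subV addUV capUV V_neq0 spM.
  exact: noN (IHd d' ltd' _ spU gU).
have [d' ltd' spV] := spanned_by_summand subV subU addVU capVU U_neq0 spM.
exact: noN (IHd d' ltd' _ spV gV).
Qed.

Lemma mod_iso_fin_dim (M N : lmodType A) :
  mod_iso M N -> fin_dim_module M -> fin_dim_module N.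
Proof.
case=> f [g fK gK] [d [e spe]]; exists d, (f \o e) => x.
have [c gx] := spe (g x); exists c.
rewrite -[x]gK gx raddf_sum; apply: eq_bigr => i _ /=.
exact: linearZZ.
Qed.

Lemma grows_infinite_rep_type :
    (forall m, exists2 M : lmodType A, fin_dim_module M & grows a b M m) ->
  infinite_rep_type A.
Proof.
move=> exM [n [L LP]].
have /choice[d dP] (i : 'I_n) : exists d,
    fin_dim_module (L i) -> ~ grows a b (L i) d.
  (* An infinite dimensional entry is isomorphic to no finite dimensional module, so any bound
     serves for it. *)
  have [[d spL]|nfL] := pselect (fin_dim_module (L i)); last by exists 0%N.
  by exists d => _; apply: spanned_by_not_grows.
have [M finM grM] := exM (\max_i d i)%N.
have [N [finN indN grN]] := grows_indecomposable finM grM.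
have [i isoNL] := LP N finN indN.
apply: (dP i); first exact: mod_iso_fin_dim finN.
by apply: grows_iso isoNL _; apply: grows_leq grN; apply: leq_bigmax.
Qed.

End GrowthAndRepresentationType.

(** * Coinduced modules *)

Section Coregular.

Variables (k : fieldType) (A : falgType k) (V : vectType k).

(** A separate name, so that the action of A, (x f)(y) = f(y x), does not clash with the k-structure
    of ['Hom(A, V)]. *)
Definition coreg : Type := 'Hom(A, V).

HB.instance Definition _ := GRing.Zmodule.copy coreg 'Hom(A, V).

Definition coreg_scale (x : A) (f : coreg) : coreg := (f \o amulr x)%VF.

Lemma coreg_scaleE x (f : coreg) y : coreg_scale x f y = f (y * x).
Proof. by rewrite comp_lfunE lfunE. Qed.

Fact coreg_scaleA x y (f : coreg) :
  coreg_scale x (coreg_scale y f) = coreg_scale (x * y) f.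
Proof. by apply/lfunP => z; rewrite !coreg_scaleE mulrA. Qed.

Fact coreg_scale1 : left_id 1 coreg_scale.
Proof. by move=> f; apply/lfunP => z; rewrite coreg_scaleE mulr1. Qed.

Fact coreg_scaleDr : right_distributive coreg_scale +%R.
Proof.
by move=> x f g; apply/lfunP => z; rewrite coreg_scaleE !add_lfunE !coreg_scaleE.
Qed.

Fact coreg_scaleDl f : {morph coreg_scale^~ f : x y / x + y}.
Proof.
move=> x y; apply/lfunP => z.
by rewrite add_lfunE !coreg_scaleE mulrDr linearD.
Qed.

HB.instance Definition _ := GRing.Zmodule_isLmodule.Build A coreg
  coreg_scaleA coreg_scale1 coreg_scaleDr coreg_scaleDl.

Lemma coregZ x (f : coreg) y : (x *: f) y = f (y * x).
Proof. exact: coreg_scaleE. Qed.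

Lemma coregZ_scalar (c : k) (f : coreg) :
  c%:A *: f = (c *: (f : 'Hom(A, V))) :> 'Hom(A, V).
Proof.
by apply/lfunP => z; rewrite coregZ scale_lfunE -scalerAr mulr1 linearZ.
Qed.

End Coregular.

(** * The nilpotent Jordan block, moving the entries of a row one place to the right *)

Section Shift.

Variables (k : fieldType) (n : nat).

Definition shift_mx : 'M[k]_n := \matrix_(i, j) (j == i.+1 :> nat)%:R.

Lemma shift_mxE (r : 'rV[k]_n) (i j : 'I_n) :
  j = i.+1 :> nat -> (r *m shift_mx) 0 j = r 0 i.
Proof.
move=> ji; rewrite mxE (bigD1 i) //= mxE ji eqxx mulr1 big1 ?addr0 // => l li.
by rewrite mxE ji eqSS (inj_eq val_inj) eq_sym (negPf li) mulr0.
Qed.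

Lemma shift_mx0 (r : 'rV[k]_n) (j : 'I_n) :
  j = 0%N :> nat -> (r *m shift_mx) 0 j = 0.
Proof. by move=> j0; rewrite mxE big1 // => i _; rewrite mxE j0 mulr0. Qed.

End Shift.

(** * Modules of prescribed growth *)

Section CommonEigenvectors.

Variables (k : fieldType) (A : falgType k) (a b : A) (eps : A -> k).
Hypotheses (mul_xa : forall x, x * a = eps x *: a).
Hypotheses (mul_ax : forall x, a * x = eps x *: a).
Hypotheses (mul_xb : forall x, x * b = eps x *: b).
Hypotheses (mul_bx : forall x, b * x = eps x *: b).
Hypothesis free_ab : free [:: a; b].

Section Module.

Variable n : nat.
Local Notation S := (shift_mx k n).
Local Notation E := (coreg A 'rV[k]_n).

Definition shift_stable (f : E) : Prop := f b = f a *m S.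

(** Passing from f to x f multiplies the values at a and at b by the same scalar eps(x). *)
Fact shift_stable_submodule : submodule shift_stable.
Proof.
split=> [|x f g]; rewrite /shift_stable; first by rewrite !zero_lfunE mul0mx.
move=> fE gE; rewrite !add_lfunE !coregZ mul_bx mul_ax !linearZ /= fE gE.
by rewrite mulmxDl scalemxAl.
Qed.

Local Notation W := (submod_type shift_stable_submodule).

Lemma shift_stable_fin_dim : fin_dim_module W.
Proof.
pose phi (f : 'Hom(A, 'rV[k]_n)) := f b - f a *m S.
have phi_lin : linear phi.
  move=> c f g; rewrite /phi !lfunE /= !lfunE /= mulmxDl -scalemxAl scalerBr.
  by rewrite opprD addrACA.
pose phiM := GRing.isLinear.Build _ _ _ _ phi phi_lin.
pose phiL : {linear _ -> _} := HB.pack phi phiM.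
pose K := lker (linfun phiL).
have KP (f : E) : (f \in K) <-> shift_stable f.
  by rewrite memv_ker lfunE /= subr_eq0; split => /eqP.
have /choice[e eP] (i : 'I_(\dim K)) :
    exists u : W, submod_val u = (vbasis K)`_i.
  by apply/submod_val_surj/KP/vbasis_mem/mem_nth; rewrite size_tuple.
exists (\dim K), e => x.
have Kx : submod_val x \in K by apply/KP; apply: submod_valP.
exists (fun i => coord (vbasis K) i (submod_val x)); apply: val_inj.
rewrite [RHS](raddf_sum (val : W -> E)) [LHS](coord_vbasis Kx).
apply: eq_bigr => i _.
by rewrite -eP -coregZ_scalar; symmetry; apply: submod_valZ.
Qed.

(** As a and b are independent, the values c at a and c S at b can be prescribed freely. *)
Lemma shift_stable_ex (c : 'rV[k]_n) : exists w : W, submod_val w a = c.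
Proof.
pose X := [tuple a; b].
have freeX : free X by [].
pose f x := coord X ord0 x *: c + coord X ord_max x *: (c *m S).
have f_lin : linear f.
  move=> t x y; rewrite /f !(linearP (coord X _)) !scalerDl scalerDr addrACA.
  by rewrite -!scalerA.
pose fM := GRing.isLinear.Build _ _ _ _ f f_lin.
pose fL : {linear _ -> _} := HB.pack f fM.
have fa : linfun fL a = c.
  rewrite lfunE /= /f -[a]/(X`_(ord0 : 'I_2)) !coord_free // eqxx.
  by rewrite scale1r scale0r addr0.
have fb : linfun fL b = c *m S.
  rewrite lfunE /= /f -[b]/(X`_(ord_max : 'I_2)) !coord_free // eqxx.
  by rewrite scale1r scale0r add0r.
have /(submod_val_surj shift_stable_submodule)[w wE] :
    shift_stable (linfun fL : E).
  by rewrite /shift_stable fb fa.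
by exists w; rewrite wE.
Qed.

(* Both a and b act through evaluation followed by eps.                        *)
Lemma shift_stable_ab (w w' : W) :
  submod_val w b = submod_val w' a -> b *: w = a *: w'.
Proof.
move=> ww'; apply: val_inj; apply/lfunP => x.
rewrite [val (b *: w)]submod_valZ [val (a *: w')]submod_valZ.
rewrite !coregZ mul_xa mul_xb.
by rewrite !linearZ /= ww'.
Qed.

(** One step back along the chain shifts the value at a; a row supported on the last j places is
    pushed out after j steps. *)
Lemma chain_shift_stable j (w : W) :
    (forall i : 'I_n, (i + j < n)%N -> submod_val w a 0 i = 0) ->
  chain a b j (a *: w).
Proof.
elim: j w => [|j IHj] w w0 /=.
  apply: val_inj; apply/lfunP => x.
  rewrite [val _]submod_valZ coregZ mul_xa linearZ zero_lfunE /=.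
  have -> : submod_val w a = 0.
    by apply/rowP => i; rewrite w0 ?addn0 ?mxE.
  exact: scaler0.
exists w => //; have [w' w'E] := shift_stable_ex (submod_val w a *m S).
have /shift_stable_ab -> : submod_val w b = submod_val w' a.
  by rewrite w'E; apply: (submod_valP w).
apply: IHj => i ijn; rewrite w'E.
have [i0|i_gt0] := posnP i; first exact: shift_mx0.
pose i' := Ordinal (leq_ltn_trans (leq_pred i) (ltn_ord i)).
by rewrite (@shift_mxE _ _ _ i') ?prednK // w0 //= addnS -addSn prednK.
Qed.

(** The value of a v at 1 is v(a), and that of b v is v(b) = v(a) S, so each step back moves the
    entries at 1 one place to the right. *)
Lemma shift_stable_chain_val j (w : W) (i : 'I_n) :
  chain a b j w -> (i + j < n)%N -> submod_val w 1 0 i = 0.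
Proof.
elim: j w i => [|j IHj] w i /=; first by move=> ->; rewrite zero_lfunE mxE.
case=> v -> /IHj bv ijn; rewrite submod_valZ coregZ mul1r.
have lt_i1n : (i.+1 < n)%N by apply: leq_ltn_trans ijn; rewrite addnS leq_addr.
rewrite -(@shift_mxE _ _ _ _ (Ordinal lt_i1n)) // -(submod_valP v).
by rewrite -[b]mul1r -coregZ -submod_valZ bv //= addSn -addnS.
Qed.

End Module.

Lemma common_eigenvectors_infinite_rep_type : infinite_rep_type A.
Proof.
apply: (@grows_infinite_rep_type k A a b) => m.
exists (submod_type (shift_stable_submodule m.+1)).
  exact: shift_stable_fin_dim.
(* The first basis row of k^(m+1) survives m shifts but not m + 1. *)
have [w wE] := @shift_stable_ex m.+1 (delta_mx 0 0).
exists (a *: w).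
  by apply: chain_shift_stable => i; rewrite addnS ltnS ltnNge leq_addl.
move=> /(shift_stable_chain_val (i := ord0))/(_ (ltnSn m))/eqP.
by rewrite submod_valZ coregZ mul1r wE mxE !eqxx oner_eq0.
Qed.

End CommonEigenvectors.

(** * Sums over images of singular matrices *)

Section SumsOverSingularImages.

Variables (k : fieldType) (F : finFieldType) (V : lmodType k).
Hypothesis cardF0 : #|F|%:R = 0 :> k.

Lemma sum_const_fin (x : V) : \sum_(c : F) x = 0.
Proof. by rewrite sumr_const -scaler_nat cardF0 scale0r. Qed.

(* The group F acts freely on P with f invariant, h recording the position in   *)
(* each orbit; so the sum of f is |F| times its sum over the slice h = 0.       *)
Lemma sum_free_action0 (D : finType) (P : pred D) (f : D -> V)
    (s : F -> D -> D) (h : D -> F) :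
    (forall c, cancel (s c) (s (- c))) -> (forall c d, P (s c d) = P d) ->
    (forall c d, P d -> f (s c d) = f d) ->
    (forall c d, P d -> h (s c d) = h d + c) ->
  \sum_(d | P d) f d = 0.
Proof.
move=> sK Ps fs hs; rewrite (partition_big h predT) //=.
rewrite -[RHS](sum_const_fin (\sum_(d | P d && (h d == 0)) f d)).
apply: eq_bigr => c _; rewrite (reindex (s c)) /=; last first.
  by exists (s (- c)) => d _; [apply: sK | rewrite -{1}[c]opprK; apply: sK].
apply: eq_big => d; rewrite Ps; last by case/andP=> Pd _; apply: fs.
by case Pd: (P d); rewrite // hs // -subr_eq0 addrK.
Qed.

Section Matrices.

Variable n : nat.
Implicit Types (B C : 'M[F]_n) (v w : 'cV[F]_n) (u : 'rV[F]_n).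

Lemma singular_ker C :
  C \notin unitmx -> exists2 w : 'cV[F]_n, w != 0 & C *m w = 0.
Proof.
rewrite -unitmx_tr -row_free_unit -kermx_eq0 => /rowV0Pn[u /sub_kermxP uC u0].
exists u^T; first by rewrite -trmx0 (can_eq trmxK).
by rewrite -[C]trmxK -trmx_mul uC trmx0.
Qed.

(** An invertible C permutes the columns; a singular one is constant along translations by a kernel
    vector. *)
Lemma sum_mulmx_cV C (f : 'cV[F]_n -> V) :
  \sum_v f (C *m v) = (C \in unitmx)%:R *: \sum_v f v.
Proof.
have [Cunit|/singular_ker[w w_neq0 Cw]] := boolP (C \in unitmx).
  rewrite scale1r [RHS](reindex (mulmx C)) //.
  by exists (mulmx (invmx C)) => v _; [apply: mulKmx | apply: mulKVmx].
rewrite scale0r; have /cV0Pn[i wi] := w_neq0.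
apply: (@sum_free_action0 _ _ _ (fun c v => v + c *: w)
  (fun v => v i 0 / w i 0)) => //.
- by move=> c v; rewrite scaleNr addrK.
- by move=> c v _; rewrite mulmxDr -scalemxAr Cw scaler0 addr0.
- by move=> c v _; rewrite !mxE mulrDl mulfK.
Qed.

Lemma sum_mulmx_rV C (f : 'rV[F]_n -> V) :
  \sum_u f (u *m C) = (C \in unitmx)%:R *: \sum_u f u.
Proof.
have reT (g : 'rV[F]_n -> V) : \sum_u g u = \sum_v g v^T.
  by rewrite (reindex trmx) //; exists trmx => v _; apply: trmxK.
rewrite (reT f) (reT (fun u => f (u *m C))) -unitmx_tr.
rewrite -(sum_mulmx_cV C^T (fun v => f v^T)).
by apply: eq_bigr => v _; rewrite trmx_mul trmxK.
Qed.

(** If C w = 0, then C (1 + c w u) = C. A row u with u w = 0, available as n is at least 2, makes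
    these factors invertible. *)
Lemma sum_mulmx_unitl C (f : 'M[F]_n -> V) : (1 < n)%N ->
  \sum_(B in unitmx) f (C *m B)
    = (C \in unitmx)%:R *: \sum_(B in unitmx) f B.
Proof.
move=> n_gt1.
have [Cunit|/singular_ker[w w_neq0 Cw]] := boolP (C \in unitmx).
  rewrite scale1r [RHS](reindex (mulmx C)) /=; last first.
    by exists (mulmx (invmx C)) => v _; [apply: mulKmx | apply: mulKVmx].
  by apply: eq_bigl => B; rewrite unitmx_mul Cunit.
have /rowV0Pn[u /sub_kermxP uw u_neq0] : kermx w != 0.
  rewrite kermx_eq0; apply/negP => /eqP rk_w.
  by have := rank_leq_col w; rewrite rk_w leqNgt n_gt1.
rewrite scale0r; have /cV0Pn[i wi] := w_neq0.
(* B moves along the orbit of the transvections 1 + c w u, which fix u B.      *)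
pose s (c : F) B := B + c *: (w *m (u *m B)).
have us c B : u *m s c B = u *m B.
  by rewrite mulmxDr -scalemxAr mulmxA uw mul0mx scaler0 addr0.
have sK c : cancel (s c) (s (- c)).
  by move=> B; rewrite {1}/s us scaleNr addrK.
(* The chosen j depends only on u B, so it is constant on an orbit, where entry (i, j) of B moves by
   c w_i (u B)_j. The default 0 never occurs for invertible B. *)
pose h B := if [pick j | (u *m B) 0 j != 0] is Some j
  then B i j / (w i 0 * (u *m B) 0 j) else 0.
apply: (sum_free_action0 (s := s) (h := h)) => //.
- have sE c B : s c B = s c 1%:M *m B.
    by rewrite /s mulmxDl mul1mx -scalemxAl !mulmx1 -mulmxA.
  have s_unit c : s c 1%:M \in unitmx.
    have /mulmx1_unit[] // : s c 1%:M *m s (- c) 1%:M = 1%:M.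
    by rewrite -sE -{1}[c]opprK sK.
  by move=> c B; rewrite sE unitmx_mul s_unit.
- by move=> c B _; rewrite mulmxDr -scalemxAr mulmxA Cw mul0mx scaler0 addr0.
- move=> c B Bunit; rewrite /h us; case: pickP => [j uBj|uB0].
    have -> : s c B i j = B i j + c * (w i 0 * (u *m B) 0 j).
      rewrite mxE; congr (_ + _); rewrite mxE; congr (_ * _).
      by rewrite mxE big_ord1.
    by rewrite mulrDl mulfK // mulf_neq0.
  case/eqP: u_neq0; rewrite -[u](mulmxK Bunit).
  suff -> : u *m B = 0 by rewrite mul0mx.
  by apply/rowP => j; rewrite [RHS]mxE; apply/eqP/negbFE/uB0.
Qed.

Lemma sum_mulmx_unitr C (f : 'M[F]_n -> V) : (1 < n)%N ->
  \sum_(B in unitmx) f (B *m C)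
    = (C \in unitmx)%:R *: \sum_(B in unitmx) f B.
Proof.
move=> n_gt1.
have reT (g : 'M[F]_n -> V) :
    \sum_(B in unitmx) g B = \sum_(B in unitmx) g B^T.
  rewrite (reindex trmx) /=; last by exists trmx => B _; apply: trmxK.
  by apply: eq_bigl => B; rewrite unitmx_tr.
rewrite (reT f) (reT (fun B => f (B *m C))) -unitmx_tr.
rewrite -(sum_mulmx_unitl C^T (fun B => f B^T) n_gt1).
by apply: eq_bigr => B _; rewrite trmx_mul trmxK.
Qed.

End Matrices.

End SumsOverSingularImages.

(** * The elements alpha and lambda of kM(n,q) *)

Section TwoEigenvectors.

Variables (k : fieldType) (F : finFieldType) (n : nat).
Hypothesis cardF0 : #|F|%:R = 0 :> k.
Hypothesis n_gt1 : (1 < n)%N.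

Local Notation kM := (mxmonalg k F n).
Local Notation "[ 'mx' C ]" := (mxmonalg_of k C) (at level 0, C at level 200).

Definition unit_sum : kM := \sum_(B in unitmx) [mx B].

(** Summing over pairs lets left factors act on v alone and right factors on u alone. A matrix of
    rank one occurs q - 1 times. *)
Definition outer_sum : kM :=
  \sum_(v : 'cV[F]_n) \sum_(u : 'rV[F]_n) [mx v *m u].

Definition unit_aug (x : kM) : k := \sum_(C in unitmx) x C.

Lemma mxmonalg_decomp (x : kM) : x = \sum_C (x C : k) *: [mx C].
Proof.
apply/ffunP => D; rewrite sum_ffunE (bigD1 D) //= big1 ?addr0 => [|C CD].
  by rewrite !ffunE eqxx; apply/esym/mulr1.
by rewrite !ffunE eq_sym (negPf CD); apply: mulr0.
Qed.

Lemma unit_aug_mull (a : kM) :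
    (forall C, [mx C] * a = (C \in unitmx)%:R *: a) ->
  forall x, x * a = unit_aug x *: a.
Proof.
move=> Ca x; rewrite {1}[x]mxmonalg_decomp mulr_suml scaler_suml [RHS]big_mkcond.
apply: eq_bigr => C _; rewrite -scalerAl Ca.
by case: ifP; rewrite ?scale1r // scale0r scaler0.
Qed.

Lemma unit_aug_mulr (a : kM) :
    (forall C, a * [mx C] = (C \in unitmx)%:R *: a) ->
  forall x, a * x = unit_aug x *: a.
Proof.
move=> aC x; rewrite {1}[x]mxmonalg_decomp mulr_sumr scaler_suml [RHS]big_mkcond.
apply: eq_bigr => C _; rewrite -scalerAr aC.
by case: ifP; rewrite ?scale1r // scale0r scaler0.
Qed.

Lemma unit_sum_mull C : [mx C] * unit_sum = (C \in unitmx)%:R *: unit_sum.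
Proof.
rewrite mulr_sumr -(sum_mulmx_unitl cardF0 C (@mxmonalg_of k F n) n_gt1).
by apply: eq_bigr => B _; rewrite mxmonalg_ofM.
Qed.

Lemma unit_sum_mulr C : unit_sum * [mx C] = (C \in unitmx)%:R *: unit_sum.
Proof.
rewrite mulr_suml -(sum_mulmx_unitr cardF0 C (@mxmonalg_of k F n) n_gt1).
by apply: eq_bigr => B _; rewrite mxmonalg_ofM.
Qed.

Lemma outer_sum_mull C : [mx C] * outer_sum = (C \in unitmx)%:R *: outer_sum.
Proof.
rewrite mulr_sumr -(sum_mulmx_cV cardF0 C (fun v => \sum_u [mx v *m u])).
apply: eq_bigr => v _; rewrite mulr_sumr; apply: eq_bigr => u _.
by rewrite -mxmonalg_ofM mulmxA.
Qed.

Lemma outer_sum_mulr C : outer_sum * [mx C] = (C \in unitmx)%:R *: outer_sum.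
Proof.
rewrite mulr_suml scaler_sumr; apply: eq_bigr => v _.
rewrite mulr_suml -(sum_mulmx_rV cardF0 C (fun u => [mx v *m u])).
by apply: eq_bigr => u _; rewrite -mxmonalg_ofM mulmxA.
Qed.

Lemma unit_sum1 : unit_sum 1%:M = 1.
Proof.
rewrite sum_ffunE (bigD1 1%:M) ?unitmx1 //= ffunE eqxx big1 ?addr0 // => B.
by case/andP=> _ B1; rewrite ffunE eq_sym (negPf B1).
Qed.

Lemma outer_sum1 : outer_sum 1%:M = 0.
Proof.
rewrite sum_ffunE big1 // => v _; rewrite sum_ffunE big1 // => u _.
rewrite ffunE; case: eqP => // vu1; have := mulmx_max_rank v u.
by rewrite -vu1 mxrank1 leqNgt n_gt1.
Qed.

(** The column v = 0 contributes q^n = 0, and each of the q^n - 1 others contributes 1, from u =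
    0. *)
Lemma outer_sum0 : outer_sum 0 = -1.
Proof.
have sum1 (m l : nat) : (0 < m * l)%N -> \sum_(B : 'M[F]_(m, l)) 1 = 0 :> k.
  by move=> ml; rewrite sumr_const card_mx natrX cardF0 expr0n eqn0Ngt ml.
have sum_u (v : 'cV[F]_n) :
    (\sum_(u : 'rV[F]_n) [mx v *m u]) 0 = (v != 0)%:R.
  rewrite sum_ffunE; have [->|v_neq0] := eqVneq v 0.
    rewrite -[RHS](sum1 1%N n) ?mul1n ?(ltnW n_gt1) //.
    by apply: eq_bigr => u _; rewrite ffunE mul0mx eqxx.
  rewrite (bigD1 0) //= ffunE mulmx0 eqxx big1 ?addr0 // => u u_neq0.
  rewrite ffunE eq_sym; case: eqP => // vu0.
  have /cV0Pn[i vi] := v_neq0; have /rV0Pn[j uj] := u_neq0.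
  have /matrixP/(_ i j) := vu0; rewrite !mxE big_ord1 => /eqP.
  by rewrite mulf_eq0 (negPf vi) (negPf uj).
rewrite sum_ffunE; under eq_bigr do rewrite sum_u.
have := sum1 n 1%N; rewrite muln1 => /(_ (ltnW n_gt1)).
rewrite (bigD1 0) //= => /eqP; rewrite addrC addr_eq0 => /eqP <-.
by rewrite [RHS]big_mkcond; apply: eq_bigr => v _; case: eqP.
Qed.

(** The coefficients at the identity and at the zero matrix tell the two apart. *)
Lemma free_unit_outer_sum : free [:: unit_sum; outer_sum].
Proof.
rewrite free_cons seq1_free span_seq1; apply/andP; split.
  apply/vlineP => -[c /ffunP/(_ 1%:M)]; rewrite unit_sum1 ffunE outer_sum1.
  by rewrite scaler0 => /eqP; rewrite oner_eq0.
by apply/eqP => /ffunP/(_ 0)/eqP; rewrite outer_sum0 ffunE oppr_eq0 oner_eq0.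
Qed.

Lemma mxmonalg_infinite_rep_type : infinite_rep_type kM.
Proof.
apply: (@common_eigenvectors_infinite_rep_type k kM unit_sum outer_sum unit_aug).
- exact/unit_aug_mull/unit_sum_mull.
- exact/unit_aug_mulr/unit_sum_mulr.
- exact/unit_aug_mull/outer_sum_mull.
- exact/unit_aug_mulr/outer_sum_mulr.
- exact: free_unit_outer_sum.
Qed.

End TwoEigenvectors.

(** * Semisimplicity of a product of fields *)

Section ProductOfFields.

Variables (R : pzRingType) (k : fieldType) (q : nat).
Variable f : R -> {ffun 'I_q -> k^o}.
Hypotheses (fD : {morph f : x y / x + y}) (fM : {morph f : x y / x * y}).
Hypothesis f_bij : bijective f.

(** The simple left ideals are the preimages of the coordinate lines; division in k carries any
    nonzero element of one to any other. *)
Lemma semisimple_product_of_fields : semisimple_ring R.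
Proof.
case: f_bij => g fK gK.
have fME x y i : f (x * y) i = f x i * f y i :> k by rewrite fM ffunE.
have fDE x y i : f (x + y) i = f x i + f y i :> k by rewrite fD ffunE.
have f0E i : f 0 i = 0 :> k.
  by apply: (@addrI _ (f 0 i)); rewrite -fDE !addr0.
have fsum (I : finType) (u : I -> R) i :
    f (\sum_j u j) i = \sum_j f (u j) i :> k.
  by apply: (big_morph (fun x => f x i : k)) => // x y; apply: fDE.
pose d i (c : k) : R := g [ffun j => if j == i then c else 0].
have fd i c j : f (d i c) j = (if j == i then c else 0) :> k.
  by rewrite gK ffunE.
pose U i (x : R^o) := forall j, j != i -> f x j = 0 :> k.
have UE i x : U i x -> x = d i (f x i).
  move=> Ux; apply: (can_inj fK); apply/ffunP => j; rewrite fd.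
  by case: eqVneq => [->|/Ux].
have subU i : submodule (U i).
  split=> [j _|a x y Ux Uy j ji]; first exact: f0E.
  by rewrite fDE fME Ux // Uy // mulr0 addr0.
exists q, U; split=> [i|x].
  split=> //.
    exists (d i 1) => [j /negPf ji|d0]; first by rewrite fd ji.
    by have /eqP := fd i 1 i; rewrite d0 f0E eqxx eq_sym oner_eq0.
  move=> W [W0 WD] WU.
  have [W_zero|W_nzero] := pselect (zero_submodule W); [by left | right].
  have [w Ww w_neq0] : exists2 w, W w & w <> 0.
    apply: contrapT => nW; apply: W_nzero => x Wx.
    by apply: contrapT => x_neq0; apply: nW; exists x.
  have fwi : f w i != 0 :> k.
    apply/eqP => fwi; apply: w_neq0; apply: (can_inj fK); apply/ffunP => j.
    by rewrite (UE _ _ (WU _ Ww)) fd fwi f0E; case: ifP.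
  move=> x Ux.
  suff -> : x = d i (f x i / f w i) *: w by rewrite -[_ *: _]addr0; apply: WD.
  apply: (can_inj fK); apply/ffunP => j.
  rewrite [RHS]fME fd; case: eqVneq => [->|ji]; first by rewrite divfK.
  by rewrite Ux // mul0r.
exists [ffun i => d i (f x i)]; split.
  split=> [i j /negPf ji|]; first by rewrite ffunE fd ji.
  apply: (can_inj fK); apply/ffunP => j; rewrite [RHS]fsum (bigD1 j) //= big1.
    by rewrite addr0 ffunE fd eqxx.
  by move=> i /negPf ij; rewrite ffunE fd eq_sym ij.
move=> u [Uu xE]; apply/ffunP => i; rewrite ffunE [RHS](UE i) //; congr (d i _).
rewrite xE [LHS]fsum (bigD1 i) //= big1 ?addr0 // => j /negPf ji.
by rewrite Uu // eq_sym ji.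
Qed.

End ProductOfFields.

(** * The case n = 1 *)

Section OneByOneMatrices.

Variables (F : finFieldType) (k : fieldType) (iota : {rmorphism F -> k}).
Variable q : nat.
Hypothesis cardF : #|F| = q.

Local Notation kM := (mxmonalg k F 1).

(* At i = 0 the convention 0 ^+ 0 = 1 makes the zero matrix count.             *)
Definition power_chars (h : kM) : {ffun 'I_q -> k^o} :=
  [ffun i : 'I_q => \sum_A h A * iota (A 0 0) ^+ i : k].

Lemma power_chars_linear : linear power_chars.
Proof.
move=> c g h; apply/ffunP => i; rewrite !ffunE scaler_sumr -big_split.
by apply: eq_bigr => A _; rewrite !ffunE /= mulrDl -scalerAl.
Qed.

Lemma power_chars_monoid_morphism : monoid_morphism power_chars.
Proof.
split.
  apply/ffunP => i; rewrite !ffunE (bigD1 1%:M) //= ffunE eqxx.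
  rewrite mxE eqxx mulr1n rmorph1 expr1n mulr1 big1 ?addr0 // => A /negPf A1.
  by rewrite ffunE A1 mul0r.
move=> g h; apply/ffunP => i; rewrite !ffunE.
rewrite (mxmonalg_mul_sum g h (fun A => iota (A 0 0) ^+ i)) mulr_suml.
apply: eq_bigr => A _; rewrite mulr_sumr; apply: eq_bigr => B _.
by rewrite mxE big_ord1 rmorphM exprMn mulrACA.
Qed.

Let elt (i : 'I_q) : F := enum_val (cast_ord (esym cardF) i).
Let idx (x : F) : 'I_q := cast_ord cardF (enum_rank x).

Let eltK : cancel elt idx.
Proof. by move=> i; rewrite /idx enum_valK cast_ordKV. Qed.

Let idxK : cancel idx elt.
Proof. by move=> x; rewrite /elt cast_ordK enum_rankK. Qed.

Let V : 'M[k]_q := Vandermonde q (\row_j iota (elt j)).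

Let V_unit : V \in unitmx.
Proof.
rewrite unitmxE unitfE det_Vandermonde; apply/prodf_neq0 => i _.
apply/prodf_neq0 => j ij; rewrite !mxE subr_eq0 (inj_eq (fmorph_inj iota)).
by rewrite (can_eq eltK) neq_ltn ij orbT.
Qed.

(** In the basis of field elements, [power_chars] is multiplication by the Vandermonde matrix
    [V]. *)
Lemma power_chars_bij : bijective power_chars.
Proof.
pose col (h : kM) : 'cV[k]_q := \col_j h (elt j)%:M.
pose lift (y : 'cV[k]_q) : kM := [ffun A : 'M[F]_1 => y (idx (A 0 0)) 0].
have colK : cancel col lift.
  by move=> h; apply/ffunP => A; rewrite !ffunE mxE idxK -mx11_scalar.
have liftK : cancel lift col.
  by move=> y; apply/colP => j; rewrite mxE ffunE mxE eqxx mulr1n eltK.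
have power_charsE h i : power_chars h i = (V *m col h) i 0.
  rewrite ffunE mxE (reindex (fun j => (elt j)%:M : 'M[F]_1)) /=; last first.
    exists (fun A : 'M[F]_1 => idx (A 0 0)) => [j _|A _].
      by rewrite mxE eqxx mulr1n eltK.
    by rewrite idxK -mx11_scalar.
  by apply: eq_bigr => j _; rewrite !mxE eqxx mulr1n mulrC.
exists (fun y : {ffun 'I_q -> k^o} =>
  lift (invmx V *m \col_i (y i : k))) => [h|y].
  rewrite -[RHS]colK; congr lift; rewrite -[RHS](mulKmx V_unit); congr (_ *m _).
  by apply/colP => i; rewrite mxE power_charsE.
apply/ffunP => i; rewrite power_charsE liftK mulKVmx //; exact: mxE.
Qed.

End OneByOneMatrices.

Theorem theorem3p14 (p e q : nat) (F : finFieldType) (k : fieldType)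
    (iota : {rmorphism F -> k})
    (p_prime : prime p) (e_gt0 : (0 < e)%N) (qE : q = (p ^ e)%N)
    (cardF : #|F| = q) (char_k : p \in [pchar k]) :
  (forall n : nat, (2 <= n)%N -> infinite_rep_type (mxmonalg k F n)) /\
  (exists f : mxmonalg k F 1 -> {ffun 'I_q -> k^o},
     [/\ linear f, monoid_morphism f & bijective f]) /\
  semisimple_ring (mxmonalg k F 1).
Proof.
have lin := @power_chars_linear F k iota q.
have mor := power_chars_monoid_morphism iota q.
have bij := power_chars_bij iota cardF.
split=> [n n_gt1|].
  apply: mxmonalg_infinite_rep_type n_gt1.
  by rewrite cardF qE natrX (pcharf0 char_k) expr0n eqn0Ngt e_gt0.
split; first by exists (power_chars iota q).
apply: semisimple_product_of_fields bij; last exact: mor.2.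
by move=> x y; have := lin 1 x y; rewrite !scale1r.
Qed.
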